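(* Let $\Gamma$ be a quiver with vertices $1,\dots,n$ and companion matrix $[a_{ij}]$, $\theta:\mathbb{Z}^n\to\mathbb{Z}$ a stability function, $\mu\in\mathbb{Q}$ and $\mathbb{F}_q$ a finite field. Let $\lambda_*=(\lambda^1,\dots,\lambda^n)\in\mathcal{P}^n$ be an $n$-tuple of partitions, put $\alpha=(|\lambda^1|,\dots,|\lambda^n|)\in\mathbb{N}^n$, and let $$g=(I+J_{\lambda^1},\dots,I+J_{\lambda^n})\in\mathrm{GL}(\alpha,\mathbb{F}_q),$$ where $I$ denotes the identity matrix. Let $X_g=\{M\in\mathrm{R}_\mu^{ss}(\alpha,\mathbb{F}_q)\mid g\cdot M=M\}$. Then $$|X_g|=q^{\sum_{1\le i,j\le n}a_{ij}\langle\!\langle\lambda^i,\lambda^j\rangle\!\rangle}\prod_{s\ge1}|\mathrm{R}_\mu^{ss}(\lambda_*^{(s)},\mathbb{F}_q)|.$$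
   Context: The quiver $\Gamma$ with companion matrix $[a_{ij}]$ ($n\times n$, entries in $\mathbb{N}$) has vertices $1,\dots,n$ and $a_{ij}$ arrows from $i$ to $j$. $\mathrm{Rep}(\alpha,\mathbb{F}_q)=\bigoplus_{i\to j}\mathrm{Hom}(\mathbb{F}_q^{\alpha_i},\mathbb{F}_q^{\alpha_j})$ is the space of representations with dimension vector $\alpha$. The group $\mathrm{GL}(\alpha,\mathbb{F}_q)=\prod_i\mathrm{GL}(\alpha_i,\mathbb{F}_q)$ acts on it: $g=(g_i)$ replaces the map $V_a$ of an arrow $a:i\to j$ by $g_jV_ag_i^{-1}$. $\theta$ is additive; the slope of a nonzero representation with dimension vector $\beta$ is $\theta(\beta)/\mathrm{ht}(\beta)$ with $\mathrm{ht}(\beta)=\sum_i\beta_i$. A representation is semistable if every nonzero proper subrepresentation has slope at most its slope (the zero representation counts as semistable). Put $\Delta_\mu^+=\{\beta\in\mathbb{N}^n:\theta(\beta)=\mu\cdot\mathrm{ht}(\beta)\}$. For $\beta\in\Delta_\mu^+$, $\mathrm{R}_\mu^{ss}(\beta,\mathbb{F}_q)$ is the set of semistable representations in $\mathrm{Rep}(\beta,\mathbb{F}_q)$; for $\beta\in\mathbb{N}^n\setminus\Delta_\mu^+$ it is empty; for $\beta=0$ it has one element. $\mathcal{P}$ is the set of all partitions (including the empty one). For $\lambda\in\mathcal{P}$: $|\lambda|$ is the sum of its parts; $J_\lambda$ is the $|\lambda|\times|\lambda|$ block-diagonal nilpotent matrix whose blocks are Jordan blocks with eigenvalue $0$ (ones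 on the superdiagonal) of sizes $\lambda_1,\lambda_2,\dots$; $m_\lambda^{(k)}$ is the number of parts equal to $k$; $\lambda'_i=\sum_{k\ge i}m_\lambda^{(k)}$. Also $\lambda_*^{(s)}=(m_{\lambda^1}^{(s)},\dots,m_{\lambda^n}^{(s)})\in\mathbb{N}^n$, and $$\langle\!\langle\lambda,\nu\rangle\!\rangle=\sum_{i\ge1}\lambda'_i\nu'_i-\sum_{i\ge1}m_\lambda^{(i)}m_\nu^{(i)}.$$ *)

(* Defs.v *)
From mathcomp Require Import all_boot all_order all_algebra.
From mathcomp Require Import boolp classical_sets fsbigop.

Set Implicit Arguments.
Unset Strict Implicit.
Unset Printing Implicit Defensive.

Import Order.TTheory GRing.Theory Num.Theory.
Local Open Scope ring_scope.

(* A quiver on the vertices 'I_n is given by its companion matrix a. *)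
Section Quiver.

Variables (n : nat) (a : 'M[nat]_n).

(* The arrows from i to j are the elements of 'I_(a i j). *)
Definition arrow : finType := {ij : 'I_n * 'I_n & 'I_(a ij.1 ij.2)}.

Definition src (x : arrow) : 'I_n := (tag x).1.
Definition tgt (x : arrow) : 'I_n := (tag x).2.

Variables (F : finFieldType) (alpha : 'I_n -> nat).

(* Matrices act on column vectors: Hom(F^r, F^s) is 'M[F]_(s, r). *)
Definition Rep : finType :=
  {dffun forall x : arrow, 'M[F]_(alpha (tgt x), alpha (src x))}.

(* mathcomp's 'GL_m[F] is not GL(m, F) when m = 0, whence this type. *)
Record GL : Type := MkGL {
  gl_val :> forall i, 'M[F]_(alpha i);
  gl_unit : forall i, gl_val i \in unitmx
}.

Definition act (g : GL) (M : Rep) : Rep :=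
  [ffun x : arrow => g (tgt x) *m M x *m invmx (g (src x))].

Definition subrep (M : Rep) (U : forall i, {vspace 'cV[F]_(alpha i)}) : Prop :=
  forall (x : arrow) (v : 'cV[F]_(alpha (src x))),
    v \in U (src x) -> M x *m v \in U (tgt x).

End Quiver.

Section Stability.

Variables (n : nat) (theta : {additive 'rV[int]_n -> int}).

Definition ht (beta : 'I_n -> nat) : nat := (\sum_i beta i)%N.

Definition theta_dim (beta : 'I_n -> nat) : int :=
  theta (\row_i (beta i)%:Z).

Definition slope (beta : 'I_n -> nat) : rat :=
  (theta_dim beta)%:~R / (ht beta)%:R.

Definition Delta_plus (mu : rat) (beta : 'I_n -> nat) : bool :=
  (theta_dim beta)%:~R == mu * (ht beta)%:R.

Definition semistable (a : 'M[nat]_n) (F : finFieldType) (alpha : 'I_n -> nat)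
    (M : Rep a F alpha) : Prop :=
  forall U : (forall i, {vspace 'cV[F]_(alpha i)}),
    subrep M U ->
    (exists i, U i != 0%VS) -> (exists i, U i != fullv) ->
    slope (fun i => \dim (U i)) <= slope alpha.

Definition Rss (a : 'M[nat]_n) (F : finFieldType) (mu : rat)
    (alpha : 'I_n -> nat) : {set Rep a F alpha} :=
  [set M : Rep a F alpha | Delta_plus mu alpha && `[< semistable M >]].

Definition fixed_Rss (a : 'M[nat]_n) (F : finFieldType) (mu : rat)
    (alpha : 'I_n -> nat) (g : GL F alpha) : {set Rep a F alpha} :=
  [set M in Rss a F mu alpha | act g M == M].

End Stability.

(* The infinite sums and products below have finite support, so that fsbigop's
   \big[_/_]_(_ \in _) really is their value. *)
Section Partitions.

Local Open Scope nat_scope.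

Definition is_partition (l : seq nat) : bool := sorted geq l && (0 \notin l).

(* The sum of the parts, in the form that \mxdiag uses for its size. *)
Definition psize (l : seq nat) : nat := \sum_(k < size l) nth 0 l k.

Definition mult (l : seq nat) (k : nat) : nat := count_mem k l.

Definition conj_part (l : seq nat) (i : nat) : nat :=
  \big[addn/0]_(k \in [set k | i <= k]%classic) mult l k.

(* The subtraction does not truncate, as mult l i <= conj_part l i. *)
Definition pairing (l m : seq nat) : nat :=
  \big[addn/0]_(i \in [set i | 1 <= i]%classic) (conj_part l i * conj_part m i)
  - \big[addn/0]_(i \in [set i | 1 <= i]%classic) (mult l i * mult m i).

Definition part_dim (n : nat) (lam : 'I_n -> seq nat) (i : 'I_n) : nat :=
  psize (lam i).

Definition star (n : nat) (lam : 'I_n -> seq nat) (s : nat) (i : 'I_n) : nat :=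
  mult (lam i) s.

End Partitions.

Section Jordan.

Variable F : finFieldType.

Definition jordan_block (m : nat) : 'M[F]_m :=
  \matrix_(i, j) ((j : nat) == i.+1)%:R.

Definition jordan (l : seq nat) : 'M[F]_(psize l) :=
  \mxdiag_(k < size l) jordan_block (nth 0%N l k).

Lemma jordan_block_unit m : 1%:M + jordan_block m \in unitmx.
Proof.
rewrite -unitmx_tr unitmxE det_trig; last first.
  apply/is_trig_mxP => i j ltij; rewrite !mxE.
  by rewrite -val_eqE /= gtn_eqF// ltn_eqF ?addr0// ltnS ltnW.
by rewrite big1 ?unitr1// => i _; rewrite !mxE eqxx ltn_eqF// addr0.
Qed.

Lemma jordan_unit l : 1%:M + jordan l \in unitmx.
Proof.
pose B (k : 'I_(size l)) : 'M[F]_(nth 0%N l k) :=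
  invmx (1%:M + jordan_block (nth 0%N l k)).
suff /mulmx1_unit[] : (1%:M + jordan l) *m (\mxdiag_k B k) = 1%:M by [].
rewrite -[in LHS]mxdiagZ -mxdiagD [X in X *m _]/mxdiag mul_mxblock_mxdiag.
rewrite -mxdiagZ /mxdiag.
apply/eq_mxblock => i j; case: eqP => [eij|_].
  by case: j / eij; rewrite !conform_mx_id mulmxV ?jordan_block_unit.
by rewrite mul0mx.
Qed.

Definition unipotent (n : nat) (lam : 'I_n -> seq nat) :
    GL F (part_dim lam) :=
  @MkGL n F (part_dim lam) (fun i => 1%:M + jordan (lam i))
    (fun i => jordan_unit (lam i)).

End Jordan.

(* Main.v *)
(** Fixed points of g are the representations M that commute with the nilpotent
    operator N = (J_(lambda^i)), that is, quiver representations over F[t] on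
    the modules of types lambda^i.  The s-th graded piece of M is the
    representation that M induces on (ker N ∩ im N^(s-1)) / (ker N ∩ im N^s);
    it has dimension vector lambda_*^(s).

    With the additive function theta - mu ht, semistability of slope mu says
    that the value is 0 on M and at most 0 on every subrepresentation.  If M is
    such, the subrepresentations of value 0 are stable under sums and
    intersections and contain ker N^k and im N^k, whence all graded pieces are
    semistable of slope mu.  Conversely, a subrepresentation U of M is filtered
    by the U ∩ ker N^k, the quotients of this filtration embed by N^k into
    ker N ∩ im N^k, and these are filtered by the graded pieces.

    It remains to count the M with given graded pieces.  In Jordan bases each
    matrix of M is blockwise Toeplitz, and it is determined by free entries of
    which <<lambda^i, lambda^j>> many do not show up in the graded pieces. *)
Require Import Defs.
From mathcomp Require Import all_boot all_order all_algebra.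
From mathcomp Require Import boolp classical_sets fsbigop.
From mathcomp Require Import zify lra.

Set Implicit Arguments.
Unset Strict Implicit.
Unset Printing Implicit Defensive.

Import Order.TTheory GRing.Theory Num.Theory.
Local Open Scope ring_scope.

Definition mulf (F : fieldType) p m (A : 'M[F]_(p, m)) :
  'Hom('cV[F]_m, 'cV[F]_p) := linfun (mulmx A).

Lemma mulfE (F : fieldType) p m (A : 'M[F]_(p, m)) v : mulf A v = A *m v.
Proof. by rewrite /mulf lfunE. Qed.

Lemma dim_cV (F : fieldType) m : \dim {:'cV[F]_m} = m.
Proof. by rewrite dimvf dim_matrix mulr1. Qed.

(** * Semistability through an additive defect *)

Section Defect.

Variables (n : nat) (theta : {additive 'rV[int]_n -> int}) (mu : rat).

(** Unlike the slope, this is additive along exact sequences. *)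
Definition defect (b : 'I_n -> nat) : rat :=
  (theta_dim theta b)%:~R - mu * (ht b)%:R.

Lemma eq_defect b c : b =1 c -> defect b = defect c.
Proof. by move=> /funext ->. Qed.

Lemma defectD b c : defect (fun i => b i + c i)%N = defect b + defect c.
Proof.
rewrite /defect /theta_dim /ht big_split natrD.
have -> : \row_i (b i + c i)%N%:Z = \row_i (b i)%:Z + \row_i (c i)%:Z.
  by apply/rowP => i; rewrite !mxE PoszD.
by rewrite raddfD intrD mulrDr opprD addrACA.
Qed.

Lemma defect0 : defect (fun=> 0%N) = 0.
Proof.
have /eqP := defectD (fun=> 0%N) (fun=> 0%N).
by rewrite -subr_eq0 opprD addNKr oppr_eq0 => /eqP.
Qed.

Variables (a : 'M[nat]_n) (F : finFieldType).

(** Multiplying by the positive height turns slope at most [mu] into defect at most 0. The zero and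
    the full subrepresentation have defect 0, so the quantifier may run over all
    subrepresentations. *)
Lemma Rss_defectP alpha (M : Rep a F alpha) :
  reflect (defect alpha = 0 /\
           forall U, subrep M U -> defect (fun i => \dim (U i)) <= 0)
          (M \in Rss theta a F mu alpha).
Proof.
rewrite inE /Delta_plus -subr_eq0 -/(defect alpha).
have ht_gt0 U i : U i != 0%VS :> {vspace 'cV[F]_(alpha i)} ->
    (0 < ht (fun i => \dim (U i)))%N.
  by rewrite -dimv_eq0 /ht (bigD1 i) //= addn_gt0 lt0n => ->.
have slopeE U i : defect alpha = 0 -> U i != 0%VS :> {vspace 'cV[F]_(alpha i)} ->
    (slope theta (fun i => \dim (U i)) <= slope theta alpha) =
    (defect (fun i => \dim (U i)) <= 0).
  move=> da0 Ui0; have htU := ht_gt0 U i Ui0.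
  have hta : (0 < ht alpha)%N.
    apply: leq_trans htU _; apply: leq_sum => j _.
    by rewrite -[leqRHS](dim_cV F) dimvS ?subvf.
  have -> : slope theta alpha = mu.
    by rewrite /slope; move/eqP: da0; rewrite subr_eq0 => /eqP ->; rewrite mulfK // pnatr_eq0 -lt0n.
  by rewrite /slope ler_pdivrMr ?ltr0n // subr_le0.
apply: (iffP andP) => [[/eqP da0 /asboolP ssM] | [da0 ssM]]; split => //.
- move=> U sU; have [/existsP[i Ui0] | ] := boolP [exists i, U i != 0%VS]; last first.
    rewrite negb_exists => /forallP U0.
    rewrite (eq_defect (c := fun=> 0%N)) ?defect0 // => i.
    by apply/eqP; rewrite dimv_eq0 -[_ == _]negbK.
  have [/existsP[j Uj1] | ] := boolP [exists i, U i != fullv].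
    by rewrite -(slopeE U i da0 Ui0); apply: ssM => //; [exists i | exists j].
  rewrite negb_exists => /forallP U1.
  rewrite (eq_defect (c := alpha)) ?da0 // => j.
  by move: (U1 j); rewrite negbK => /eqP ->; rewrite dim_cV.
- exact/eqP.
- apply/asboolP => U sU [i Ui0] _; rewrite (slopeE U i) //; exact: ssM.
Qed.

End Defect.

Arguments eq_defect {n theta mu} [b c].

(** * Operations on subrepresentations *)

Section Subrep.

Variables (n : nat) (a : 'M[nat]_n) (F : finFieldType) (alpha : 'I_n -> nat).
Variable (M : Rep a F alpha).

Lemma subrepI U W : subrep M U -> subrep M W -> subrep M (fun i => (U i :&: W i)%VS).
Proof.
move=> sU sW x v; rewrite memv_cap => /andP[Uv Wv].
by rewrite memv_cap sU // sW.
Qed.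

Lemma subrepD U W : subrep M U -> subrep M W -> subrep M (fun i => (U i + W i)%VS).
Proof.
move=> sU sW x v /memv_addP[u Uu [w Ww ->]].
by rewrite mulmxDr memv_add // ?sU // sW.
Qed.

Lemma subrepf : subrep M (fun i => fullv).
Proof. by move=> x v _; rewrite memvf. Qed.

Variables (beta : 'I_n -> nat) (M' : Rep a F beta).
Variable f : forall i, 'M[F]_(beta i, alpha i).

Lemma subrep_img U : subrep M U ->
  (forall x v, v \in U (src x) ->
     f (tgt x) *m (M x *m v) = M' x *m (f (src x) *m v)) ->
  subrep M' (fun i => (mulf (f i) @: U i)%VS).
Proof.
move=> sU fM x w /memv_imgP[v Uv ->]; rewrite mulfE -fM //.
by rewrite -mulfE memv_img // sU.
Qed.

(** Compatibility of [f] is asked only on [U], since the projections to the graded pieces respect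
    the arrows only on the socles. *)
Lemma subrep_preim U W : subrep M U -> subrep M' W ->
  (forall x v, v \in U (src x) ->
     f (tgt x) *m (M x *m v) = M' x *m (f (src x) *m v)) ->
  subrep M (fun i => (U i :&: mulf (f i) @^-1: W i)%VS).
Proof.
move=> sU sW fM x v; rewrite !memv_cap -!memv_preim !mulfE => /andP[Uv Wv].
by rewrite sU //= fM // sW.
Qed.

Lemma subrep_ker :
  (forall x, f (tgt x) *m M x = M' x *m f (src x)) ->
  subrep M (fun i => lker (mulf (f i))).
Proof.
move=> fM x v; rewrite !memv_ker !mulfE mulmxA fM -mulmxA => /eqP ->.
by rewrite mulmx0.
Qed.

End Subrep.

(** * Semistability of M and of its graded pieces *)

Section Graded.

Variables (n : nat) (theta : {additive 'rV[int]_n -> int}) (mu : rat).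
Variables (a : 'M[nat]_n) (F : finFieldType) (alpha : 'I_n -> nat).
Variable M : Rep a F alpha.
Variable N : nat -> forall i, 'M[F]_(alpha i).
Variable T : nat.

Hypothesis N0 : forall i, N 0 i = 1%:M.
Hypothesis NS : forall k i, N k.+1 i = N 1 i *m N k i.
Hypothesis NT : forall i, N T i = 0.
Hypothesis NM : forall k x, N k (tgt x) *m M x = M x *m N k (src x).

(* The nilpotent operator is N 1, and N k is its k-th power. *)
Definition socle s i : {vspace 'cV[F]_(alpha i)} :=
  (lker (mulf (N 1 i)) :&: limg (mulf (N s i)))%VS.

(** The map [pi s] presents [gr s] as [socle s] modulo [socle s.+1] without forming a quotient
    space. Indices start at 0, so [gr s] is the graded piece of level s + 1. *)
Variable m : nat -> 'I_n -> nat.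
Variable pi : forall s i, 'M[F]_(m s i, alpha i).
Variable gr : forall s, Rep a F (m s).
Hypothesis pi_ker : forall s i, (socle s i :&: lker (mulf (pi s i)) = socle s.+1 i)%VS.
Hypothesis pi_img : forall s i, (mulf (pi s i) @: socle s i)%VS = fullv.
Hypothesis piM : forall s x v, v \in socle s (src x) ->
  pi s (tgt x) *m (M x *m v) = gr s x *m (pi s (src x) *m v).

Local Notation d U := (defect theta mu (fun i => \dim (U i))).

Lemma subrep_ker_pow k : subrep M (fun i => lker (mulf (N k i))).
Proof. exact: (@subrep_ker _ _ _ _ M _ M (N k) (NM k)). Qed.

Lemma subrep_img_pow k U : subrep M U -> subrep M (fun i => (mulf (N k i) @: U i)%VS).
Proof.
move=> sU; apply: (@subrep_img _ _ _ _ M _ M (N k) U sU) => x v _.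
by rewrite mulmxA NM mulmxA.
Qed.

Lemma subrep_socle s : subrep M (socle s).
Proof.
apply: subrepI; first exact: subrep_ker_pow.
exact/subrep_img_pow/subrepf.
Qed.

(** Rank-nullity at each vertex. *)
Lemma defect_ker_img (beta : 'I_n -> nat) (f : forall i, 'M[F]_(beta i, alpha i))
    (U : forall i, {vspace 'cV[F]_(alpha i)}) :
  d U = d (fun i => U i :&: lker (mulf (f i)))%VS + d (fun i => mulf (f i) @: U i)%VS.
Proof.
by rewrite -defectD; apply: eq_defect => i; rewrite limg_ker_dim.
Qed.

Lemma defect_socle s : d (socle s) = d (socle s.+1) + defect theta mu (m s).
Proof.
rewrite (defect_ker_img (pi s)); congr (_ + _); apply: eq_defect => i.
  by rewrite pi_ker.
by rewrite pi_img dim_cV.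
Qed.

Lemma socleT i : socle T i = 0%VS.
Proof.
apply/eqP; rewrite -subv0; apply/subvP => v; rewrite memv_cap => /andP[_].
by case/memv_imgP => u _ ->; rewrite mulfE NT mul0mx mem0v.
Qed.

Lemma img_ker_sub_socle k U i :
  (mulf (N k i) @: (U i :&: lker (mulf (N k.+1 i))) <= socle k i)%VS.
Proof.
rewrite /socle; apply/subvP => w /memv_imgP[v]; rewrite !(memv_cap, memv_ker) !mulfE NS.
by move=> /andP[_ /eqP kv] ->; rewrite mulmxA kv eqxx -mulfE memv_img ?memvf.
Qed.

Lemma img_ker_eq_socle k i : (mulf (N k i) @: lker (mulf (N k.+1 i)) = socle k i)%VS.
Proof.
apply/eqP; rewrite eqEsubv -{1}(capfv (lker _)) (img_ker_sub_socle k (fun=> fullv)) /=.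
apply/subvP => w; rewrite !(memv_cap, memv_ker) => /andP[+ /memv_imgP[v _ def_w]].
rewrite def_w !mulfE => kv; rewrite -(mulfE (N k i)) memv_img //.
by rewrite memv_ker mulfE NS -mulmxA.
Qed.

Lemma defect_full_step k U :
  d (fun i => U i :&: lker (mulf (N k.+1 i)))%VS =
  d (fun i => U i :&: lker (mulf (N k i)))%VS +
  d (fun i => mulf (N k i) @: (U i :&: lker (mulf (N k.+1 i))))%VS.
Proof.
rewrite (defect_ker_img (N k)); congr (_ + _); apply: eq_defect => i.
rewrite -capvA; congr (\dim (_ :&: _)); apply/capv_idPr/subvP => v.
by rewrite !memv_ker !mulfE NS -mulmxA => /eqP ->; rewrite mulmx0.
Qed.

Lemma ker_pow0 i : lker (mulf (N 0 i)) = 0%VS.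
Proof. by apply/eqP/lker0P => u v; rewrite !mulfE N0 !mul1mx. Qed.

Lemma ker_powT i : lker (mulf (N T i)) = fullv.
Proof.
apply/eqP; rewrite eqEsubv subvf; apply/subvP => v _.
by rewrite memv_ker mulfE NT mul0mx.
Qed.

Lemma Rss_graded : M \in Rss theta a F mu alpha -> forall s, gr s \in Rss theta a F mu (m s).
Proof.
move=> /Rss_defectP[da ssM].
pose deg0 U := subrep M U /\ d U = 0.
have deg0f : deg0 (fun=> fullv).
  split; [exact: subrepf | rewrite -da; apply: eq_defect => i; exact: dim_cV].
(* Kernel and image of [N k] have defects at most 0 with sum the defect 0 of M, so both vanish. *)
have deg0_ker k : deg0 (fun i => lker (mulf (N k i))) /\
                  deg0 (fun i => limg (mulf (N k i))).
  have sk := @subrep_ker_pow k; have si := @subrep_img_pow k _ (@subrepf _ _ _ _ M).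
  have := defect_ker_img (N k) (fun=> fullv); rewrite deg0f.2.
  rewrite [X in _ = X + _](eq_defect (c := fun i => \dim (lker (mulf (N k i))))); last first.
    by move=> i; rewrite capfv.
  have := ssM _ sk; have := ssM _ si; rewrite /deg0 => h1 h2 h3.
  by split; split=> //; lra.
(* The same argument for the sum and the intersection, by the dimension formula. *)
have deg0I U W : deg0 U -> deg0 W -> deg0 (fun i => U i :&: W i)%VS.
  move=> [sU dU] [sW dW]; have sI := subrepI sU sW; split=> //.
  have := ssM _ (subrepD sU sW); have := ssM _ sI.
  have : d (fun i => U i + W i)%VS + d (fun i => U i :&: W i)%VS = d U + d W.
    by rewrite -!defectD; apply: eq_defect => i; rewrite dimv_sum_cap.
  rewrite dU dW => h1 h2 h3; lra.
have d_socle s : d (socle s) = 0 by apply: (deg0I _ _ _ _).2; apply deg0_ker.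
move=> s; apply/Rss_defectP; split.
  by have := defect_socle s; rewrite !d_socle add0r.
(* The preimage of [W] in [socle s] is an extension of [W] by [socle s.+1], which has defect 0;
   hence it has the defect of [W]. *)
move=> W sW; have := ssM _ (subrep_preim (@subrep_socle s) sW (@piM s)).
rewrite (defect_ker_img (pi s)) (eq_defect (c := fun i => \dim (socle s.+1 i))).
  rewrite d_socle add0r (eq_defect (c := fun i => \dim (W i))) // => i.
  congr (\dim _); apply/vspaceP => w; apply/memv_imgP/idP => [[v] | Ww].
    by rewrite memv_cap -memv_preim => /andP[_ Wv] ->.
  have: w \in (mulf (pi s i) @: socle s i)%VS by rewrite pi_img memvf.
  by case/memv_imgP => v Kv def_w; exists v; rewrite // memv_cap Kv -memv_preim -def_w.
move=> i; rewrite -pi_ker -capvA; congr (\dim (_ :&: _)); apply/capv_idPr/subvP => v.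
by rewrite memv_ker -memv_preim => /eqP ->; rewrite mem0v.
Qed.

Lemma graded_Rss : (forall s, (s < T)%N -> gr s \in Rss theta a F mu (m s)) ->
  M \in Rss theta a F mu alpha.
Proof.
move=> ssgr.
(* Descending induction from [socle T], which is 0. *)
have d_socle s : (s <= T)%N -> d (socle s) = 0.
  move=> leT; rewrite -(subKn leT); elim: (T - s)%N (leq_subr s T) => [|k IH] lek.
    rewrite subn0 -(defect0 theta mu); apply: eq_defect => i.
    by rewrite socleT dimv0.
  rewrite defect_socle subnSK // IH ?(ltnW lek) // add0r.
  have lt : (T - k.+1 < T)%N by lia.
  by have /Rss_defectP[] := ssgr _ lt.
(* Again descending: [U] meets [socle s.+1] in a subrepresentation covered by induction, and [pi s]
   maps [U] onto a subrepresentation of [gr s]. *)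
have le0_socle s U : (s <= T)%N -> subrep M U -> (forall i, U i <= socle s i)%VS -> d U <= 0.
  move=> leT; rewrite -(subKn leT).
  elim: (T - s)%N (leq_subr s T) U => [|k IH] lek U sU subU.
    rewrite (eq_defect (c := fun=> 0%N)) ?defect0 // => i.
    by apply/eqP; rewrite dimv_eq0 -subv0 -(socleT i); move: (subU i); rewrite subn0.
  set t := (T - k.+1)%N in subU.
  have tS : (T - k = t.+1)%N by rewrite /t; lia.
  rewrite tS in IH.
  have tT : (t < T)%N by rewrite /t; lia.
  rewrite (defect_ker_img (pi t)) (eq_defect (c := fun i => \dim (U i :&: socle t.+1 i))); last first.
    by move=> i; rewrite -pi_ker capvA (capv_idPl (subU i)).
  have /Rss_defectP[_ ssg] := ssgr t tT.
  rewrite -[leRHS]addr0 lerD //.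
    by apply: IH; [lia | exact/subrepI/subrep_socle | move=> i; exact: capvSr].
  apply: ssg; apply: subrep_img sU _ => x v Uv; apply: piM.
  exact: (subvP (subU _)).
apply/Rss_defectP; split.
  have -> : defect theta mu alpha = d (fun i => fullv :&: lker (mulf (N T i)))%VS.
    by apply: eq_defect => i; rewrite ker_powT capvv dim_cV.
  (* For M itself the quotients of the kernel filtration are the whole socles; for [U] below they
     are only contained in them. *)
  suff d_ker k : (k <= T)%N -> d (fun i => fullv :&: lker (mulf (N k i)))%VS = 0.
    exact: d_ker.
  elim: k => [|k IH] lek.
    rewrite -(defect0 theta mu); apply: eq_defect => i.
    by rewrite ker_pow0 capv0 dimv0.
  rewrite defect_full_step IH 1?ltnW // add0r -(d_socle k (ltnW lek)).
  by apply: eq_defect => i; rewrite capfv img_ker_eq_socle.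
move=> U sU; have -> : d U = d (fun i => U i :&: lker (mulf (N T i)))%VS.
  by apply: eq_defect => i; rewrite ker_powT capvf.
suff d_ker k : (k <= T)%N -> d (fun i => U i :&: lker (mulf (N k i)))%VS <= 0.
  exact: d_ker.
elim: k => [|k IH] lek.
  rewrite (eq_defect (c := fun=> 0%N)) ?defect0 // => i.
  by rewrite ker_pow0 capv0 dimv0.
rewrite defect_full_step -[leRHS]addr0 lerD ?IH 1?ltnW //.
apply: (le0_socle k); first exact: ltnW.
  exact/subrep_img_pow/subrepI/subrep_ker_pow.
exact: img_ker_sub_socle.
Qed.

End Graded.

(** * Jordan bases and powers of the Jordan matrix *)

Section Slots.

Variable l : seq nat.
Implicit Types i j : 'I_(psize l).

Definition blk i : 'I_(size l) := tagnat.sig1 i.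
Definition off i : nat := tagnat.sig2 i.
Definition wd i : nat := nth 0%N l (blk i).

(* The basis of F^(psize l) is indexed by pairs of a Jordan block and an offset
   in it; slot i p has the block of i and offset p.  If p is not smaller than
   wd i, then slot i p is i. *)
Definition slot i (p : nat) : 'I_(psize l) :=
  @tagnat.Rank _ (fun k => nth 0%N l k) _ (insubd (tagnat.sig2 i) p).

Lemma off_lt i : (off i < wd i)%N.
Proof. exact: ltn_ord. Qed.

Lemma slot_inj i j : blk i = blk j -> off i = off j -> i = j.
Proof.
move=> eb eo; apply: val_inj; apply/eqP => /=.
rewrite -[i]tagnat.sig2K -[j]tagnat.sig2K tagnat.eq_Rank.
by apply/andP; split; apply/eqP.
Qed.

Lemma blk_slot i p : blk (slot i p) = blk i.
Proof. exact: tagnat.Rank1K. Qed.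

Lemma wd_slot i p : wd (slot i p) = wd i.
Proof. by rewrite /wd blk_slot. Qed.

Lemma off_slot i p : (p < wd i)%N -> off (slot i p) = p.
Proof. by move=> lp; rewrite /off /slot tagnat.Rank2K /= val_insubd lp. Qed.

Lemma slot_off i j : blk i = blk j -> slot i (off j) = j.
Proof.
move=> eb; apply: slot_inj; rewrite ?blk_slot ?off_slot // /wd eb; exact: off_lt.
Qed.

Lemma slot0 i : off i = 0%N -> slot i 0 = i.
Proof. by move=> <-; exact: slot_off. Qed.

Lemma slot_slot i p q : (q < wd i)%N -> slot (slot i p) q = slot i q.
Proof. by move=> lq; apply: slot_inj; rewrite ?blk_slot // !off_slot ?wd_slot. Qed.

Variable F : fieldType.

(** The s-th power of the Jordan matrix: it lowers the offset of a basis vector by s within its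
    block, or kills it. *)
Definition shift_mx s : 'M[F]_(psize l) :=
  \matrix_(i, j) ((blk i == blk j) && (off j == off i + s)%N)%:R.

Lemma shift_mx_next s i k : (off i + s < wd i)%N ->
  shift_mx s i k = (k == slot i (off i + s))%:R.
Proof.
move=> lt; rewrite mxE; congr (_%:R); apply: congr1; apply/andP/eqP => [[/eqP eb /eqP eo]|->].
  by rewrite -eo slot_off.
by rewrite blk_slot off_slot.
Qed.

Lemma shift_mx_prev s k j : (s <= off j)%N ->
  shift_mx s k j = (k == slot j (off j - s))%:R.
Proof.
move=> le; have lt := off_lt j.
rewrite mxE; congr (_%:R); apply: congr1; apply/andP/eqP => [[/eqP eb /eqP eo]|->].
  by rewrite eo addnK slot_off.
rewrite blk_slot off_slot ?subnK //; exact: leq_ltn_trans (leq_subr _ _) lt.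
Qed.

Lemma shift_mx_out s i k : (wd i <= off i + s)%N -> shift_mx s i k = 0.
Proof.
move=> le; rewrite mxE; case: eqP => //= eb; case: eqP => // eo.
by have := off_lt k; rewrite /wd -eb -/(wd i) eo ltnNge le.
Qed.

Lemma shift_mx_low s k j : (off j < s)%N -> shift_mx s k j = 0.
Proof.
move=> lt; rewrite mxE; case: eqP => //= eb; case: eqP => // eo.
by move: lt; rewrite eo ltnNge leq_addl.
Qed.

Lemma mul_shift_mx s p (A : 'M[F]_(psize l, p)) i k :
  (shift_mx s *m A) i k =
  if (off i + s < wd i)%N then A (slot i (off i + s)) k else 0.
Proof.
rewrite mxE; case: ltnP => [lt|le]; last first.
  by rewrite big1 // => j _; rewrite shift_mx_out ?mul0r.
rewrite (bigD1 (slot i (off i + s))) //= shift_mx_next // eqxx mul1r.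
by rewrite big1 ?addr0 // => j /negPf nj; rewrite shift_mx_next // nj mul0r.
Qed.

Lemma mul_mx_shift s p (A : 'M[F]_(p, psize l)) k j :
  (A *m shift_mx s) k j = if (s <= off j)%N then A k (slot j (off j - s)) else 0.
Proof.
rewrite mxE; case: leqP => [le|lt]; last first.
  by rewrite big1 // => i _; rewrite shift_mx_low ?mulr0.
rewrite (bigD1 (slot j (off j - s))) //= shift_mx_prev // eqxx mulr1.
by rewrite big1 ?addr0 // => i /negPf ni; rewrite shift_mx_prev // ni mulr0.
Qed.

Lemma shift_mx0 : shift_mx 0 = 1%:M.
Proof.
apply/matrixP => i j; rewrite shift_mx_next ?addn0 ?off_lt // slot_off // mxE.
by rewrite eq_sym.
Qed.

Lemma shift_mxS s : shift_mx s.+1 = shift_mx 1 *m shift_mx s.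
Proof.
apply/matrixP => i j; rewrite mul_shift_mx; case: ltnP => [lt|le].
  by rewrite !mxE blk_slot off_slot // -addnA.
by rewrite shift_mx_out ?mxE //; lia.
Qed.

Lemma shift_mx_eq0 s : (forall i, wd i <= s)%N -> shift_mx s = 0.
Proof.
move=> le; apply/matrixP => i j; rewrite shift_mx_out ?mxE //.
exact: leq_trans (le i) (leq_addl _ _).
Qed.

(** The kernel is spanned by the basis vectors of offset 0, and such a vector is an s-th shift when
    its block has more than s slots. *)
Lemma socle_shiftP s (v : 'cV[F]_(psize l)) :
  reflect (forall i, v i 0 != 0 -> off i = 0%N /\ (s < wd i)%N)
          (v \in lker (mulf (shift_mx 1)) :&: limg (mulf (shift_mx s)))%VS.
Proof.
apply: (iffP idP).
  rewrite memv_cap memv_ker mulfE => /andP[/eqP kv /memv_imgP[u _ def_v]] i vi.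
  have off0 : off i = 0%N.
    apply/eqP; rewrite -leqn0 leqNgt; apply/negP => lt.
    have lti := off_lt i.
    (* The row just before [i] in the vanishing product is the entry of v at [i]. *)
    have /matrixP /(_ (slot i (off i).-1) 0) := kv.
    rewrite mul_shift_mx mxE wd_slot off_slot; last by lia.
    rewrite addn1 prednK // lti slot_slot // slot_off // => v0.
    by rewrite v0 eqxx in vi.
  split=> //; rewrite ltnNge; apply: contraNN vi => le.
  by rewrite def_v mulfE mul_shift_mx off0 add0n ltnNge le.
move=> sv; rewrite memv_cap memv_ker mulfE; apply/andP; split.
  apply/eqP/colP => i; rewrite mul_shift_mx mxE; case: ltnP => // lt.
  apply/eqP; apply: contraT => /sv[]; rewrite off_slot //; lia.
(* The transpose raises offsets by s, and the blocks that support v are long enough for the shift to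
   undo this. *)
apply/memv_imgP; exists ((shift_mx s)^T *m v); rewrite ?memvf // mulfE.
apply/colP => i; rewrite mul_shift_mx; case: ltnP => [lt|le]; last first.
  by apply/eqP; apply: contraT => /sv[]; lia.
rewrite -[_ *m v]trmxK mxE trmx_mul trmxK mul_mx_shift off_slot // leq_addl addnK.
by rewrite mxE slot_slot ?slot_off ?off_lt.
Qed.

End Slots.

Lemma jordanE (F : finFieldType) l : jordan F l = shift_mx l F 1.
Proof.
apply/matrixP => i j; rewrite !mxE /blk /off.
move: (tagnat.sig2 i) (tagnat.sig2 j).
move: (tagnat.sig1 i) (tagnat.sig1 j) => x y u v.
case: (eqVneq x y) => [e|ne].
  by case: y / e v => v; rewrite conform_mx_id mxE addn1.
by rewrite mxE.
Qed.

(** * Matrices commuting with the Jordan matrices *)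

Section Intertwiners.

Variables (l m : seq nat) (F : finFieldType).
Implicit Types (V W : 'M[F]_(psize l, psize m)) (i : 'I_(psize l)) (j : 'I_(psize m)).

Definition intertwines V : bool := shift_mx l F 1 *m V == V *m shift_mx m F 1.

Lemma intertwinesP V :
  reflect (forall i j,
    (if (off i + 1 < wd i)%N then V (slot i (off i + 1)) j else 0) =
    (if (1 <= off j)%N then V i (slot j (off j - 1)) else 0))
  (intertwines V).
Proof.
apply: (iffP eqP) => [/matrixP eV i j | eV].
  by rewrite -mul_shift_mx -mul_mx_shift.
by apply/matrixP => i j; rewrite mul_shift_mx mul_mx_shift.
Qed.

Lemma intertwines_shift s V : intertwines V ->
  shift_mx l F s *m V = V *m shift_mx m F s.
Proof.
move=> /eqP cV; elim: s => [|s IH]; first by rewrite !shift_mx0 mul1mx mulmx1.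
by rewrite (shift_mxS l F s) (shift_mxS m F s) -mulmxA IH mulmxA cV mulmxA.
Qed.

(** The relation moves an entry one step up its diagonal, and gives 0 in a first column below the
    first row; induction on the row offset. *)
Lemma intertwines_diag V i j : intertwines V ->
  V i j = if (off i <= off j)%N then V (slot i 0) (slot j (off j - off i)) else 0.
Proof.
move=> /intertwinesP cV; move: {2}(off i) (erefl (off i)) => p.
elim: p i j => [|p IH] i j oi.
  by rewrite oi subn0 slot0 // slot_off.
have lti := off_lt i; have ltj := off_lt j.
have oi' : off (slot i p) = p by rewrite off_slot //; lia.
have := cV (slot i p) j; rewrite oi' wd_slot addn1 -oi lti slot_slot // slot_off //.
move=> ->; case: ltnP => [lt|le]; last by case: leqP => //; lia.
rewrite IH // !off_slot; try lia.
rewrite !slot_slot; try lia.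
have -> : (off j - 1 - p = off j - off i)%N by lia.
by have -> : (p <= off j - 1)%N = (off i <= off j)%N by lia.
Qed.

(** The diagonal through the entry leaves the block through its last row with columns to spare; the
    relation one column further equates its last entry with 0. *)
Lemma intertwines_eq0 V i j : intertwines V ->
  off i = 0%N -> (off j + wd i < wd j)%N -> V i j = 0.
Proof.
move=> cV oi lt; have lti := off_lt i.
have := intertwines_diag (slot i (wd i).-1) (slot j (off j + (wd i).-1)) cV.
rewrite !off_slot; try lia.
rewrite leq_addl addnK !slot_slot; try lia.
rewrite (slot0 oi) slot_off // => <-.
move/intertwinesP: cV => /(_ (slot i (wd i).-1) (slot j (off j + wd i))).
rewrite !off_slot; try lia.
have -> : (0 < off j + wd i)%N by lia.
rewrite wd_slot [slot (slot j _) _]slot_slot; last by lia.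
have -> : (off j + wd i - 1 = off j + (wd i).-1)%N by lia.
by case: ltnP => [|_ ->] //; lia.
Qed.

(** The first row of each block is spread along the diagonals; the second condition keeps the
    diagonals that reach the last column of the block. *)
Definition toeplitz V : 'M[F]_(psize l, psize m) :=
  \matrix_(i, j) if (off i <= off j)%N && (wd j <= off j - off i + wd i)%N
                 then V (slot i 0) (slot j (off j - off i)) else 0.

Lemma toeplitzP V : intertwines (toeplitz V).
Proof.
apply/intertwinesP => i j; have lti := off_lt i; have ltj := off_lt j.
have wi : (0 < wd i)%N by lia.
rewrite !mxE !wd_slot; case: ltnP => [lt|le]; case: (posnP (off j)) => [oj|oj].
- by rewrite off_slot // oj addn1.
- rewrite !off_slot; try lia.
  rewrite !slot_slot; try lia.
  have -> : (off j - (off i + 1) = off j - 1 - off i)%N by lia.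
  by have -> : (off i + 1 <= off j)%N = (off i <= off j - 1)%N by lia.
- by [].
- rewrite !off_slot; try lia.
  by case: andP => // -[]; lia.
Qed.

Lemma toeplitz_row V i j : off i = 0%N -> (wd j <= off j + wd i)%N ->
  toeplitz V i j = V i j.
Proof. by move=> oi le; rewrite mxE oi subn0 le /= -{1}oi !slot_off. Qed.

Lemma toeplitz_id V : intertwines V -> toeplitz V = V.
Proof.
move=> cV; apply/matrixP => i j; rewrite mxE.
have lti := off_lt i; have ltj := off_lt j.
have := intertwines_diag i j cV.
case: (leqP (off i) (off j)) => //= le ->; case: leqP => // lt.
rewrite intertwines_eq0 // !off_slot ?wd_slot //; lia.
Qed.

(* The entries of an intertwiner that determine it and that can be chosen
   freely, by toeplitz_free and toeplitz_id. *)
Definition free_entry : pred ('I_(psize l) * 'I_(psize m)) :=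
  fun u => (off u.1 == 0)%N && (wd u.2 <= off u.2 + wd u.1)%N.

(* The free entries that are recorded in the graded pieces. *)
Definition lead_entry : pred ('I_(psize l) * 'I_(psize m)) :=
  fun u => [&& off u.1 == 0, off u.2 == 0 & wd u.1 == wd u.2]%N.

Lemma lead_free u : lead_entry u -> free_entry u.
Proof. by case/and3P => o1 _ /eqP e; rewrite /free_entry o1 e leq_addl. Qed.

Lemma toeplitz_free V u : free_entry u -> toeplitz V u.1 u.2 = V u.1 u.2.
Proof. by case/andP => /eqP o1 le; exact: toeplitz_row. Qed.

Lemma eq_toeplitz V W : (forall u, free_entry u -> V u.1 u.2 = W u.1 u.2) ->
  toeplitz V = toeplitz W.
Proof.
move=> e; apply/matrixP => i j; rewrite !mxE; case: ifP => // /andP[le1 le2].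
have lti := off_lt i; have ltj := off_lt j.
apply: (e (_, _)); rewrite /free_entry /= !off_slot ?wd_slot //; lia.
Qed.

Lemma card_intertwines_lead W :
  #|[set V | intertwines V &&
             [forall u, lead_entry u ==> (V u.1 u.2 == W u.1 u.2)]]| =
  (#|F| ^ #|[predD free_entry & lead_entry]|)%N.
Proof.
pose D := [predD free_entry & lead_entry].
(* Lead entries come from [W], the other free entries from [c]. Taking [c] to be 0 outside [D] makes
   [X] injective. *)
pose X (c : {ffun 'I_(psize l) * 'I_(psize m) -> F}) : 'M[F]_(psize l, psize m) :=
  toeplitz (\matrix_(i, j) if lead_entry (i, j) then W i j else c (i, j)).
have -> : (#|F| ^ #|D| = #|pffun_on 0%R D (predT : pred F)|)%N.
  by rewrite card_pffun_on; congr (_ ^ _)%N; apply: eq_card.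
have XD c u : free_entry u -> X c u.1 u.2 = if lead_entry u then W u.1 u.2 else c u.
  by move=> fu; rewrite /X toeplitz_free // mxE -surjective_pairing.
rewrite -(card_in_imset (f := X)) => [|c c' /pffun_onP[sc _] /pffun_onP[sc' _] eX].
  apply: eq_card => V; rewrite inE; apply/andP/imsetP => [[cV /forallP lV]|[c _ ->]].
    pose c : {ffun 'I_(psize l) * 'I_(psize m) -> F} :=
      [ffun u => if D u then V u.1 u.2 else 0].
    exists c.
      apply/pffun_onP; split=> [|x _]; last by rewrite inE.
      apply/fintype.subsetP => u.
      by rewrite inE /= ffunE; case: ifP => //; rewrite eqxx.
    rewrite -[LHS]toeplitz_id //; apply: eq_toeplitz => u fu.
    rewrite mxE -surjective_pairing; case: ifP => lu.
      by apply/eqP; apply: (implyP (lV u)).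
    by rewrite ffunE ifT //; apply/andP; split; [exact: negbT lu | exact: fu].
  split; first exact: toeplitzP.
  by apply/forallP => u; apply/implyP => lu; rewrite XD ?lead_free // lu.
apply/ffunP => u; case Du: (u \in D); last first.
  have outD (c0 : {ffun _ -> F}) : 0.-support c0 \subset D -> c0 u = 0.
    by move=> /fintype.subsetP/(_ u); rewrite Du inE => H; apply/eqP; apply: contraT => /H.
  by rewrite !outD.
move: Du; rewrite !inE => /andP[/negPf nl fu].
by have := XD c u fu; rewrite eX XD // [lead_entry u]nl => ->.
Qed.

End Intertwiners.

(** * The pairing as a number of matrix entries *)

Section Counting.

Local Open Scope nat_scope.

Lemma card_pairs (I J : finType) (Q : pred (I * J)) (A : nat -> pred I)
    (B : pred J) (g : J -> nat) T :
  (forall i j, Q (i, j) = B j && A (g j) i) ->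
  (forall j, B j -> 0 < g j <= T) ->
  #|Q| = \sum_(t < T) #|A t.+1| * #|[pred j | B j && (g j == t.+1)]|.
Proof.
move=> QE gT; rewrite -sum1_card big_mkcond.
transitivity (\sum_i \sum_j if (i, j) \in Q then 1 else 0).
  by rewrite pair_bigA /=; apply: eq_bigr => -[].
rewrite exchange_big /=.
transitivity (\sum_(j | B j) \sum_(t < T | g j == t.+1) #|A t.+1|).
  rewrite [RHS]big_mkcond; apply: eq_bigr => j _; case: ifP => [Bj|nBj]; last first.
    by rewrite big1 // => i _; rewrite -topredE /= QE nBj.
  have /andP[g0 gleT] := gT j Bj; have ltg : (g j).-1 < T by rewrite prednK.
  rewrite (big_pred1 (Ordinal ltg)) /=.
    rewrite prednK // -sum1_card [RHS]big_mkcond; apply: eq_bigr => i _.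
    by rewrite -!topredE /= QE Bj.
  by move=> t; apply/eqP/eqP => [e|-> /=]; [apply: val_inj => /= |]; lia.
rewrite (exchange_big_dep xpredT) //=; apply: eq_bigr => t _.
by rewrite sum_nat_const mulnC.
Qed.

(** The block size fixes the offset, so each block with size in [R] contributes one slot; [h k < k]
    ensures that this slot exists. *)
Lemma card_slots l (Q : pred 'I_(psize l)) (R : pred nat) (h : nat -> nat) :
  (forall i, Q i = R (wd i) && (off i == h (wd i))) ->
  (forall k, R k -> h k < k) -> #|Q| = count R l.
Proof.
move=> QE hk; transitivity #|[pred k : 'I_(size l) | R (nth 0 l k)]|.
  rewrite -(card_in_image (f := @blk l)) => [|i j]; last first.
    rewrite -!topredE /= !QE => /andP[_ /eqP oi] /andP[_ /eqP oj] eb.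
    by apply: slot_inj; rewrite // oi oj /wd eb.
  apply: eq_card => k; rewrite [RHS]inE; apply/fintype.imageP/idP => [[i + ->]|Rk].
    by rewrite -topredE /= QE => /andP[].
  have lt := hk _ Rk; have k0 : 0 < nth 0 l k by apply: leq_trans lt.
  pose i := @tagnat.Rank _ (fun k : 'I_(size l) => nth 0 l k) k (Ordinal k0).
  have bi : blk i = k by exact: tagnat.Rank1K.
  have wi : wd i = nth 0 l k by rewrite /wd bi.
  exists (slot i (h (nth 0 l k))); last by rewrite blk_slot bi.
  by rewrite -topredE /= QE wd_slot off_slot wi // Rk /=.
rewrite -[count R l]sum1_count (big_nth 0) big_mkord -sum1_card.
by apply: eq_bigl => k; rewrite inE.
Qed.

Lemma fsbig_pos (R : Type) (idx : R) (op : Monoid.com_law idx) (f : nat -> R) T :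
  (forall s, T < s -> f s = idx) ->
  \big[op/idx]_(s \in [set s | 1 <= s]%classic) f s = \big[op/idx]_(s < T) f s.+1.
Proof.
move=> f0; rewrite (fsbigE (iota 1 T)) ?iota_uniq //.
- have -> : iota 1 T = map S (index_iota 0 T) by rewrite /index_iota subn0 -(iotaDl 1 0).
  by rewrite big_map big_mkord; apply: eq_bigl => s; exact: mem_set.
- by move=> s /=; rewrite mem_iota => /andP[].
- move=> s /= s1; rewrite mem_iota s1 /= add1n ltnS -ltnNge; exact: f0.
Qed.

Lemma conj_partE l t : conj_part l t = count (leq t) l.
Proof.
rewrite /conj_part (fsbigE [seq x <- undup l | t <= x]).
- rewrite big_filter_cond (eq_bigl (leq t)) => [|x]; last first.
    by apply: andb_idr => tx; exact: mem_set.
  rewrite -big_filter.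
  under eq_bigr do rewrite /mult -sum1_count big_mkcond.
  rewrite exchange_big /= -sum1_count [RHS]big_mkcond; apply: eq_big_seq => x lx /=.
  rewrite -big_mkcond /= (eq_bigl (pred1 x)) // sum1_count count_uniq_mem; last first.
    by rewrite filter_uniq ?undup_uniq.
  by rewrite mem_filter mem_undup lx andbT; case: leqP.
- by rewrite filter_uniq ?undup_uniq.
- by move=> x /=; rewrite mem_filter => /andP[].
- by move=> x /= tx; rewrite mem_filter tx mem_undup => /count_memPn.
Qed.

Lemma wd_mem l (i : 'I_(psize l)) : wd i \in l.
Proof. exact: mem_nth. Qed.

Lemma pairingE l m :
  pairing l m = #|[predD @free_entry l m & @lead_entry l m]|.
Proof.
pose T := \max_(k <- l ++ m) k.
have lT k : k \in l -> k <= T.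
  by move=> lk; apply: leq_bigmax_seq; rewrite // mem_cat lk.
have mT k : k \in m -> k <= T.
  by move=> mk; apply: leq_bigmax_seq; rewrite // mem_cat mk orbT.
have count0 (R : pred nat) : (forall k, k \in m -> ~~ R k) -> count R m = 0.
  by move=> nR; apply/eqP; rewrite -leqn0 leqNgt -has_count; apply/hasPn.
rewrite /pairing (fsbig_pos _ (T := T)); last first.
  move=> s Ts; rewrite !conj_partE [count _ m]count0 ?muln0 // => k /mT kT; lia.
rewrite (fsbig_pos _ (T := T)); last first.
  move=> s Ts; rewrite /mult [count _ m]count0 ?muln0 // => k /mT kT /=; lia.
have := cardID (@lead_entry l m) (@free_entry l m).
(* Lead entries are grouped by the common block size. *)
have -> : #|[predI @free_entry l m & @lead_entry l m]| = \sum_(s < T) mult l s.+1 * mult m s.+1.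
  rewrite (eq_card (B := @lead_entry l m)); last first.
    move=> u; rewrite !inE /=; apply/andP/idP => [[]//|lu].
    by split=> //; exact: lead_free.
  rewrite (card_pairs (T := T) (g := fun j => wd j) (B := fun j => off j == 0)
     (A := fun t i => (wd i == t) && (off i == 0))).
  - apply: eq_bigr => t _; congr (_ * _).
      by rewrite (card_slots (R := pred1 t.+1) (h := fun=> 0)) // => k /eqP ->.
    rewrite (card_slots (R := pred1 t.+1) (h := fun=> 0)) // => [j|k /eqP -> //].
    by rewrite /= andbC.
  - by move=> i j; rewrite /lead_entry /= andbCA; case: (wd i == wd j); rewrite ?andbT ?andbF.
  - by move=> j _; rewrite (leq_ltn_trans _ (off_lt j)) // mT // wd_mem.
(* Free entries are grouped by t = [wd j - off j]: the row starts any block of size at least t, and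
   each column block of size at least t has exactly one such column. *)
have -> : #|@free_entry l m| = \sum_(s < T) conj_part l s.+1 * conj_part m s.+1.
  rewrite (card_pairs (T := T) (g := fun j => wd j - off j) (B := xpredT)
     (A := fun t i => (t <= wd i) && (off i == 0))).
  - apply: eq_bigr => t _; rewrite !conj_partE; congr (_ * _).
      by rewrite (card_slots (R := leq t.+1) (h := fun=> 0)) // => k; lia.
    rewrite (card_slots (R := leq t.+1) (h := fun k => k - t.+1)) // => [j|k]; last by lia.
    by rewrite /=; have := off_lt j; lia.
  - by move=> i j; rewrite /free_entry /= andbC leq_subLR.
  - by move=> j _; have := off_lt j; have := mT _ (wd_mem j); lia.
by move=> <-; rewrite addKn; apply: eq_card.
Qed.

End Counting.

(** * Leading slots and leading parts *)

Section Leading.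

Variable l : seq nat.

Lemma card_leading s :
  #|[pred i : 'I_(psize l) | (wd i == s.+1) && (off i == 0%N)]| = mult l s.+1.
Proof. by rewrite (card_slots (R := pred1 s.+1) (h := fun=> 0%N)) // => k /eqP ->. Qed.

(** These slots index a basis of the s-th socle modulo the next one. *)
Definition leading s (b : 'I_(mult l s.+1)) : 'I_(psize l) :=
  enum_val (cast_ord (esym (card_leading s)) b).

Lemma leading_inj s : injective (@leading s).
Proof. exact: inj_comp enum_val_inj (@cast_ord_inj _ _ _). Qed.

Lemma wd_leading s b : wd (@leading s b) = s.+1.
Proof. by have := enum_valP (cast_ord (esym (card_leading s)) b); rewrite inE => /andP[/eqP]. Qed.

Lemma off_leading s b : off (@leading s b) = 0%N.
Proof. by have := enum_valP (cast_ord (esym (card_leading s)) b); rewrite inE => /andP[_ /eqP]. Qed.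

Lemma leadingP s i : wd i = s.+1 -> off i = 0%N -> {b | @leading s b = i}.
Proof.
move=> wi oi; have Ai : i \in [pred i | (wd i == s.+1) && (off i == 0%N)].
  by rewrite inE wi oi !eqxx.
exists (cast_ord (card_leading s) (enum_rank_in Ai i)).
by rewrite /leading cast_ordK enum_rankK_in.
Qed.

Lemma sum_leading (V : nmodType) s (f : 'I_(psize l) -> V) :
  \sum_b f (@leading s b) = \sum_(i | (wd i == s.+1) && (off i == 0%N)) f i.
Proof.
rewrite -(big_imset f (h := @leading s) (A := predT)) /=; last first.
  by move=> b b' _ _; exact: leading_inj.
apply: eq_bigl => i; apply/imsetP/andP => [[b _ ->]|[/eqP wi /eqP oi]].
  by rewrite wd_leading off_leading.
by have [b <-] := leadingP wi oi; exists b.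
Qed.

Variable F : fieldType.

Definition leading_mx s : 'M[F]_(mult l s.+1, psize l) :=
  \matrix_(b, i) (i == leading b)%:R.

Lemma mul_leading_mx s p (A : 'M[F]_(psize l, p)) b k :
  (leading_mx s *m A) b k = A (@leading s b) k.
Proof.
rewrite mxE (bigD1 (leading b)) //= mxE eqxx mul1r.
by rewrite big1 ?addr0 // => i /negPf ni; rewrite mxE ni mul0r.
Qed.

End Leading.

Arguments leading {l} s b.

Section LeadingPart.

Variables (l m : seq nat) (F : finFieldType).

Definition leading_part s (V : 'M[F]_(psize l, psize m)) :
  'M[F]_(mult l s.+1, mult m s.+1) := mxsub (leading s) (leading s) V.

(** A socle vector is supported on initial slots of blocks longer than s; by [intertwines_eq0] those
    of size above s + 1 do not reach rows of blocks of size s + 1. *)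
Lemma leading_partM s V (v : 'cV[F]_(psize m)) : intertwines V ->
  v \in (lker (mulf (shift_mx m F 1)) :&: limg (mulf (shift_mx m F s)))%VS ->
  leading_mx l F s *m (V *m v) = leading_part s V *m (leading_mx m F s *m v).
Proof.
move=> cV /socle_shiftP sv; apply/colP => b; rewrite mul_leading_mx !mxE.
under [RHS]eq_bigr do rewrite mul_leading_mx mxE.
rewrite (sum_leading s (fun j => V (leading s b) j * v j 0)) [RHS]big_mkcond /=.
apply: eq_bigr => j _; have [->|vj] := eqVneq (v j 0) 0; first by rewrite mulr0 if_same.
have [oj lts] := sv j vj; case: ifP => // /negbT; rewrite oj eqxx andbT => nwj.
by rewrite intertwines_eq0 ?mul0r ?off_leading ?wd_leading // oj; lia.
Qed.

Lemma leading_part_surj T (Y : forall s : 'I_T, 'M[F]_(mult l s.+1, mult m s.+1)) :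
  exists W, forall s : 'I_T, leading_part s W = Y s.
Proof.
(* Different triples (s, b, b') give different positions, so all values can be placed at once. *)
exists (\matrix_(i, j) \sum_(s < T) \sum_b \sum_b'
  ((i == leading s b) && (j == leading s b'))%:R * Y s b b').
move=> s; apply/matrixP => b b'; rewrite !mxE (bigD1 s) //=.
rewrite [X in _ + X]big1 ?addr0 => [|t nts]; last first.
  rewrite big1 // => c _; rewrite big1 // => c' _.
  case: eqP => [e|]; last by rewrite mul0r.
  have := congr1 (@wd _) e; rewrite !wd_leading => -[] /val_inj est.
  by rewrite est eqxx in nts.
rewrite (bigD1 b) //= [X in _ + X]big1 ?addr0 => [|c /negPf nc]; last first.
  by rewrite big1 // => c' _; rewrite (inj_eq (@leading_inj _ _)) eq_sym nc mul0r.
rewrite (bigD1 b') //= !eqxx mul1r big1 ?addr0 // => c /negPf nc.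
by rewrite !(inj_eq (@leading_inj _ _)) [b' == c]eq_sym nc andbF mul0r.
Qed.

Lemma leading_part_eqP T V W : (forall i : 'I_(psize l), wd i <= T)%N ->
  reflect (forall s : 'I_T, leading_part s V = leading_part s W)
          [forall u, @lead_entry l m u ==> (V u.1 u.2 == W u.1 u.2)].
Proof.
move=> lT; apply: (iffP forallP) => [eVW s|eVW [i j]].
  apply/matrixP => b b'; rewrite !mxE; apply/eqP.
  apply: (implyP (eVW (leading s b, leading s b'))).
  by rewrite /lead_entry /= !wd_leading !off_leading !eqxx.
apply/implyP => /and3P[/= /eqP oi /eqP oj /eqP eij].
have lti := off_lt i; have iT := lT i.
have wi : wd i = (wd i).-1.+1 by lia.
have sT : ((wd i).-1 < T)%N by lia.
have [b <-] := leadingP wi oi.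
have [b' <-] : {b' | leading (wd i).-1 b' = j} by apply: leadingP; rewrite // -eij.
by have /matrixP/(_ b b') := eVW (Ordinal sT); rewrite !mxE => ->.
Qed.

End LeadingPart.

(** This makes almost all factors of the infinite product equal to 1. *)
Lemma card_Rss0 n (a : 'M[nat]_n) (theta : {additive 'rV[int]_n -> int}) mu F :
  #|Rss theta a F mu (fun=> 0%N)| = 1%N.
Proof.
have uniq_M (M M' : Rep a F (fun=> 0%N)) : M = M'.
  by apply/ffunP => x; rewrite [LHS]flatmx0 [RHS]flatmx0.
apply/eqP/cards1P; exists [ffun=> 0]; apply/setP => M.
rewrite (uniq_M M [ffun=> 0]) inE eqxx; apply/Rss_defectP.
split=> [|U _]; first exact: defect0.
rewrite (eq_defect (c := fun=> 0%N)) ?defect0 // => i.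
by apply/eqP; rewrite -leqn0 -[leqRHS](dim_cV F) dimvS ?subvf.
Qed.

Lemma pairingC l m : pairing l m = pairing m l.
Proof.
by rewrite /pairing; congr (_ - _)%N; apply: eq_fsbigr => i _; rewrite mulnC.
Qed.

(** * Fixed points and their graded pieces *)

Section FixedPoints.

Variables (n : nat) (a : 'M[nat]_n).
Variables (theta : {additive 'rV[int]_n -> int}) (mu : rat) (F : finFieldType).
Variables (lam : 'I_n -> seq nat).

Local Notation alpha := (part_dim lam).

Definition graded_piece (M : Rep a F alpha) s : Rep a F (star lam s.+1) :=
  [ffun x : arrow a => leading_part s (M x)].

(** Clearing the inverse and cancelling the identity summands leaves commutation with the Jordan
    matrices. *)
Lemma act_unipotentE (M : Rep a F alpha) :
  (act (unipotent F lam) M == M) = [forall x, intertwines (M x)].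
Proof.
have conjE x : ((1%:M + jordan F (lam (tgt x))) *m M x *m
    invmx (1%:M + jordan F (lam (src x))) == M x) = intertwines (M x).
  have U := jordan_unit F (lam (src x)).
  rewrite -(inj_eq (can_inj (mulmxK U))) mulmxKV // mulmxDl mulmxDr mul1mx mulmx1.
  by rewrite (inj_eq (addrI _)) !jordanE.
apply/eqP/forallP => [/ffunP eM x | cM].
  by rewrite -conjE; apply/eqP; rewrite -[RHS]eM ffunE.
by apply/ffunP => x; rewrite ffunE; apply/eqP; rewrite conjE.
Qed.

Variable T : nat.
Hypothesis lamT : forall i k, k \in lam i -> (k <= T)%N.

Lemma Rss_gradedP (M : Rep a F alpha) : (forall x, intertwines (M x)) ->
  (M \in Rss theta a F mu alpha) =
  [forall s : 'I_T, graded_piece M s \in Rss theta a F mu (star lam s.+1)].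
Proof.
move=> cM.
pose N k i : 'M[F]_(alpha i) := shift_mx (lam i) F k.
pose p s i : 'M[F]_(star lam s.+1 i, alpha i) := leading_mx (lam i) F s.
have N0 i : N 0%N i = 1%:M by exact: shift_mx0.
have NS k i : N k.+1 i = N 1%N i *m N k i by exact: shift_mxS.
have NT i : N T i = 0 by apply: shift_mx_eq0 => j; exact/lamT/wd_mem.
have NM k x : N k (tgt x) *m M x = M x *m N k (src x) by exact: intertwines_shift.
have p_ker s i : (socle N s i :&: lker (mulf (p s i)) = socle N s.+1 i)%VS.
  apply/vspaceP => v; rewrite memv_cap memv_ker mulfE.
  apply/andP/socle_shiftP => [[/socle_shiftP sv /eqP pv] j vj | sv].
    (* A coordinate at a block of size exactly s + 1 is read off by [p s], hence zero. *)
    have [oj lts] := sv j vj; split=> //; rewrite ltn_neqAle lts andbT.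
    apply: contraNN vj => /eqP wj; have [b <-] := leadingP (esym wj) oj.
    by rewrite -mul_leading_mx -[_ *m v]/(p s i *m v) pv mxE.
  split; first by apply/socle_shiftP => j /sv[oj /ltnW].
  apply/eqP/colP => b; rewrite mul_leading_mx mxE; apply/eqP/contraT => /sv[_].
  by rewrite wd_leading ltnn.
have p_img s i : (mulf (p s i) @: socle N s i)%VS = fullv.
  apply/eqP; rewrite eqEsubv subvf; apply/subvP => w _; apply/memv_imgP.
  exists ((p s i)^T *m w).
    apply/socle_shiftP => j; rewrite mxE => nz.
    have [b nb] : exists b, (p s i)^T j b * w b 0 != 0.
      apply/existsP; apply: contraNT nz; rewrite negb_exists => /forallP z.
      by rewrite big1 // => b _; apply/eqP; rewrite -[_ == _]negbK.
    move: nb; rewrite !mxE; case: (j =P _) => [-> _|_]; last by rewrite mul0r eqxx.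
    by rewrite off_leading wd_leading.
  rewrite mulfE; apply/colP => b; rewrite mul_leading_mx mxE (bigD1 b) //= !mxE eqxx mul1r.
  rewrite big1 ?addr0 // => c /negPf nc.
  by rewrite !mxE (inj_eq (@leading_inj _ _)) eq_sym nc mul0r.
have pM s x v : v \in socle N s (src x) ->
    p s (tgt x) *m (M x *m v) = graded_piece M s x *m (p s (src x) *m v).
  by move=> sv; rewrite ffunE; exact: leading_partM.
apply/idP/forallP => [ssM s | ssM].
  exact: (Rss_graded NM p_ker p_img pM ssM).
apply: (graded_Rss N0 NS NT NM p_ker p_img pM) => s lts.
exact: (ssM (Ordinal lts)).
Qed.

Local Open Scope nat_scope.

Lemma foldr_muln (I : finType) (f : I -> nat) :
  foldr muln 1 [seq f i | i : I] = \prod_i f i.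
Proof. by rewrite /image_mem foldrE big_map big_enum. Qed.

Lemma sum_arrow (f : 'I_n -> 'I_n -> nat) :
  \sum_(x : arrow a) f (tgt x) (src x) = \sum_(i < n) \sum_(j < n) a i j * f j i.
Proof.
rewrite pair_big /= (eq_bigr (fun ij : 'I_n * 'I_n => \sum_(k < a ij.1 ij.2) f ij.2 ij.1)).
  by rewrite sig_big_dep.
by move=> ij _; rewrite sum_nat_const card_ord.
Qed.

Lemma card_graded_fiber
    (Y : {dffun forall s : 'I_T, Rep a F (star lam s.+1)}) :
  #|[set M : Rep a F alpha | [forall x, intertwines (M x)] &&
                             [forall s : 'I_T, graded_piece M s == Y s]]| =
  #|F| ^ (\sum_(i < n) \sum_(j < n) a i j * pairing (lam i) (lam j)).
Proof.
(* The lead entries of this lift are the prescribed ones; the fibre is then a product over the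
   arrows of sets of the same size for every [Y]. *)
have [W WY] : exists W : Rep a F alpha, forall s : 'I_T, graded_piece W s = Y s.
  have H x := leading_part_surj (fun s : 'I_T => Y s x).
  exists [ffun x => projT1 (cid (H x))] => s; apply/ffunP => x.
  by rewrite !ffunE; case: (cid (H x)) => V /= ->.
pose A x := [set V : 'M[F]_(alpha (tgt x), alpha (src x)) | intertwines V &&
  [forall u, lead_entry u ==> (V u.1 u.2 == W x u.1 u.2)]].
have lamTi i j : wd (j : 'I_(psize (lam i))) <= T by exact/lamT/wd_mem.
transitivity #|(family A : simpl_pred (Rep a F alpha))|.
  apply: eq_card => M; rewrite inE; apply/andP/familyP => [[/forallP cM /forallP gM] x|AM].
    rewrite inE cM /=; apply/(@leading_part_eqP _ _ _ T) => // s.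
    have := WY s; rewrite -(eqP (gM s)) => /ffunP/(_ x).
    by rewrite !ffunE => ->.
  split; first by apply/forallP => x; have := AM x; rewrite inE => /andP[].
  apply/forallP => s; rewrite -WY; apply/eqP/ffunP => x; rewrite !ffunE.
  by have := AM x; rewrite inE => /andP[_ /(@leading_part_eqP _ _ _ T)]; apply.
rewrite card_family foldr_muln.
under eq_bigr do rewrite /A card_intertwines_lead -pairingE.
rewrite -expn_sum; congr (_ ^ _).
rewrite (sum_arrow (fun i j => pairing (lam i) (lam j))).
(* The matrix of an arrow from i to j has its rows indexed by [lam j], so the pairing appears with
   its arguments exchanged. *)
by under eq_bigr => i _ do under eq_bigr => j _ do rewrite pairingC.
Qed.

Lemma card_fixed_Rss :
  #|fixed_Rss theta a mu (unipotent F lam)| =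
    #|F| ^ (\sum_(i < n) \sum_(j < n) a i j * pairing (lam i) (lam j))
    * \prod_(s < T) #|Rss theta a F mu (star lam s.+1)|.
Proof.
pose G M : {dffun forall s : 'I_T, Rep a F (star lam s.+1)} :=
  [ffun s : 'I_T => graded_piece M s].
pose R : forall s : 'I_T, pred (Rep a F (star lam s.+1)) :=
  fun s => mem (Rss theta a F mu (star lam s.+1)).
have fixedP M : (M \in fixed_Rss theta a mu (unipotent F lam)) =
    [forall x, intertwines (M x)] && (G M \in family R).
  rewrite [LHS]finset.in_set act_unipotentE andbC; case: forallP => //= cM.
  rewrite (Rss_gradedP cM); apply/forallP/familyP => H s;
  by have := H s; rewrite ?ffunE.
(* The fixed points are sorted by their families of semistable graded pieces; all fibres have equal
   size. *)
rewrite -sum1_card (partition_big G (mem (family R))) /=; last first.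
  by move=> M; rewrite fixedP => /andP[].
rewrite (eq_bigr (fun=> #|F| ^ (\sum_(i < n) \sum_(j < n) a i j * pairing (lam i) (lam j)))).
  by rewrite sum_nat_const card_family foldr_muln mulnC.
move=> Y RY; rewrite -(card_graded_fiber Y) -sum1_card; apply: eq_bigl => M.
rewrite fixedP inE -andbA; congr (_ && _).
apply/andP/forallP => [[_ /eqP <-] s|GY]; first by rewrite ffunE.
have <- : G M = Y by apply/ffunP => s; rewrite ffunE; exact/eqP.
split=> //; suff -> : G M = Y by [].
by apply/ffunP => s; rewrite ffunE; exact/eqP.
Qed.

End FixedPoints.

Local Open Scope nat_scope.

Theorem theorem2p3 (n : nat) (a : 'M[nat]_n)
    (theta : {additive 'rV[int]_n -> int}) (mu : rat) (F : finFieldType)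
    (lam : 'I_n -> seq nat) (Hlam : forall i, is_partition (lam i)) :
  #|fixed_Rss theta a mu (unipotent F lam)| =
    #|F| ^ (\sum_(i < n) \sum_(j < n) a i j * pairing (lam i) (lam j))
    * \big[muln/1]_(s \in [set s | 1 <= s]%classic) #|Rss theta a F mu (star lam s)|.
Proof.
(* Above the largest part all multiplicities vanish, so the product stops at T. *)
pose T := \max_i \max_(k <- lam i) k.
have lamT i k : k \in lam i -> k <= T.
  by move=> lk; apply: leq_trans (leq_bigmax i); apply: leq_bigmax_seq.
rewrite (card_fixed_Rss a theta mu F lamT) (fsbig_pos _ (T := T)) // => s lts.
have -> : star lam s = fun=> 0.
  apply: funext => i; apply/count_memPn/negP => /lamT; lia.
apply: card_Rss0.
Qed.
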